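(* Define polynomials $S_m(q)$ ($m\ge0$) by $S_0(q)=1$ and, for $m\ge1$, $$S_m(q)=q^{2m-1}S_{m-1}(q)+\sum_{k=0}^{m-1}q^{2(k+1)(m-1-k)}S_{m-1-k}(q)\,S_k(q).$$ For integers $n,t\ge0$ let $$S^{(t)}_n(q)=\left(q^{(i-j)(i-j-1)}S_{i+j+t}(q)\right)_{0\le i,j\le n-1}.$$ Let $n$ be a positive integer. (i) $$\det S^{(1)}_{n-1}(q)=\det S^{(0)}_n(q)=\prod_{k=1}^{n-1}\left(q^{2k-1}+1\right)^{n-k}.$$ (ii) $$\det S^{(2)}_n(q)=q^{-1}\prod_{k=1}^{n}\left(q^{2k-1}+1\right)^{n+1-k}\left(\prod_{k=1}^{n+1}\left(q^{2k-1}+1\right)-1\right).$$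
   Context: $q$ is an indeterminate. The determinant of the empty ($0\times0$) matrix is $1$ and empty products equal $1$. *)

(* Defs.v *)
From mathcomp Require Import all_boot all_order all_algebra.

Set Implicit Arguments.
Unset Strict Implicit.
Unset Printing Implicit Defensive.

Import GRing.Theory Num.Theory.
Local Open Scope ring_scope.

(* The indeterminate q is 'X : {poly int}.  Slist m is [:: S_0; ...; S_m]:
   the course-of-values recursion for Sq is carried by a list, and Sq_rec below
   is the recursion itself. *)
Fixpoint Slist (m : nat) : seq {poly int} :=
  if m is m'.+1 then
    let s := Slist m' in
    rcons s
      ('X ^+ (2 * m - 1) * s`_m'
       + \sum_(0 <= k < m) 'X ^+ (2 * (k + 1) * (m - 1 - k))
                           * s`_(m - 1 - k) * s`_k)
  else [:: 1].

Definition Sq (m : nat) : {poly int} := (Slist m)`_m.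

Lemma size_Slist m : size (Slist m) = m.+1.
Proof. by elim: m => //= m IHm; rewrite size_rcons IHm. Qed.

Lemma nth_Slist m i : (i <= m)%N -> (Slist m)`_i = Sq i.
Proof.
elim: m => [|m IHm]; first by rewrite leqn0 => /eqP->.
rewrite leq_eqVlt => /predU1P[-> //|lt_im].
by rewrite /= nth_rcons size_Slist lt_im IHm.
Qed.

Lemma Sq_0 : Sq 0 = 1.
Proof. by []. Qed.

Lemma Sq_rec m : (0 < m)%N ->
  Sq m = 'X ^+ (2 * m - 1) * Sq (m - 1)
        + \sum_(0 <= k < m) 'X ^+ (2 * (k + 1) * (m - 1 - k))
                            * Sq (m - 1 - k) * Sq k.
Proof.
case: m => // m _; rewrite {1}/Sq [Slist _.+1]/= nth_rcons size_Slist ltnn eqxx.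
rewrite subSS subn0; congr (_ * _ + _).
rewrite !big_nat; apply: eq_bigr => k /andP[_ lt_km].
by rewrite !nth_Slist // leq_subr.
Qed.

(* (i - j)(i - j - 1) is computed in int, where it is never negative (see
   Sexp_ge0), so taking its absolute value only casts it to nat. *)
Definition Sexp (i j : nat) : nat :=
  absz ((i%:Z - j%:Z) * (i%:Z - j%:Z - 1)).

Lemma Sexp_ge0 (i j : nat) : 0 <= (i%:Z - j%:Z) * (i%:Z - j%:Z - 1).
Proof.
case: (i%:Z - j%:Z) => [[|a]|a]; first by rewrite mul0r.
  by rewrite mulr_ge0 // subr_ge0.
by rewrite mulr_le0 // subr_le0.
Qed.

Lemma SexpE (i j : nat) :
  (Sexp i j)%:Z = (i%:Z - j%:Z) * (i%:Z - j%:Z - 1).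
Proof. by rewrite /Sexp gez0_abs // Sexp_ge0. Qed.

Definition Smx (t n : nat) : 'M[{poly int}]_n :=
  \matrix_(i < n, j < n) ('X ^+ Sexp i j * Sq (i + j + t)).

(* Main.v *)
(** Since [(i-j)(i-j-1) = (2i^2-i) + (2j^2+j) - (i+j)^2], rescaling rows and
    columns turns the matrices into Hankel matrices of [s_m = q^(-m^2) S_m].
    With [p = 1/q] and [Q = p^2], the series [f = sum_m s_m x^m] satisfies
    [f(x) = 1 + x f(x) + p x f(x) f(Q x)]; substituting [f(x) = F(Q x) / F(x)]
    linearizes this equation, and contiguous relations of the q-hypergeometric
    series [F] expand [f] as a Stieltjes fraction with coefficients
    [Q^k (1 + p Q^k)] and [p Q^(2k+1)], alternately.  So [s_m] counts weighted
    Dyck paths, which factors the Hankel matrices into triangular ones: this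
    gives (i).  The matrix of (ii) is the minor of index (0,0) of
    the one in (i) of size n+1, and the factorization expresses that entry of the
    inverse as a telescoping sum. *)
Require Import Defs.
From mathcomp Require Import all_boot all_order all_algebra.
From mathcomp Require Import ring zify.
Import GRing.Theory.
Local Open Scope ring_scope.

(** * Weighted Dyck prefixes and their orthogonality relations *)

Section DyckPaths.

Variables (R : comNzRingType) (a b : nat -> R).

(* [dyck_even m h] and [dyck_odd m h] weigh the Dyck prefixes from height 0 of
   length 2m ending at height 2h, resp. of length 2m+1 ending at height 2h+1;
   a step down to height 2h has weight [a h], one to 2h+1 weight [b h]. *)
Fixpoint dyck_even (m : nat) : nat -> R :=
  if m is m'.+1 then fun h =>
    let odd_row h := dyck_even m' h + b h * dyck_even m' h.+1 in
    (if h is h'.+1 then odd_row h' else 0) + a h * odd_row h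
  else fun h => (h == 0)%:R.

Definition dyck_odd (m h : nat) : R :=
  dyck_even m h + b h * dyck_even m h.+1.

Local Notation U := dyck_even.
Local Notation V := dyck_odd.

Lemma dyck_evenS0 m : U m.+1 0 = a 0 * V m 0.
Proof. by rewrite /= add0r. Qed.

Lemma dyck_evenSS m h : U m.+1 h.+1 = V m h + a h.+1 * V m h.+1.
Proof. by []. Qed.

Arguments dyck_even : simpl never.

Lemma dyck_even_gt m h : (m < h)%N -> U m h = 0.
Proof.
elim: m h => [|m IHm] [|h] //= lt_mh.
by rewrite dyck_evenSS /V !IHm ?(mulr0, addr0) //; lia.
Qed.

Lemma dyck_odd_gt m h : (m < h)%N -> V m h = 0.
Proof. by move=> lt_mh; rewrite /V !dyck_even_gt ?mulr0 ?addr0 // ltnW. Qed.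

Lemma dyck_odd_diag m : V m m = U m m.
Proof. by rewrite /V (@dyck_even_gt m m.+1) // mulr0 addr0. Qed.

Lemma dyck_even_diag m : U m m = 1.
Proof.
elim: m => // m IHm.
by rewrite dyck_evenSS dyck_odd_diag IHm dyck_odd_gt // mulr0 addr0.
Qed.

(** The weight of the straight descent from height 2h to 0; a prefix ending at height 2h, read
    backwards, gains exactly this factor. The next definition does the same for height 2h+1. *)
Definition even_weight (h : nat) : R := \prod_(i < h) (a i * b i).

Definition odd_weight (h : nat) : R := even_weight h * a h.

Local Notation w := even_weight.
Local Notation v := odd_weight.

(* The transfer matrix is self-adjoint for the weighted form. *)
Lemma dyck_even_shift N i j : (j < N)%N ->
  \sum_(h < N) U i.+1 h * U j h * w h = \sum_(h < N) V i h * V j h * v h.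
Proof.
case: N => // N; rewrite ltnS => le_jN.
transitivity (\sum_(h < N.+1) a h * V i h * U j h * w h +
   \sum_(h < N.+1) V i h * U j h.+1 * w h.+1).
  (* The second sum is shifted by one in [h]; its top term vanishes because [j <= N]. *)
  rewrite [X in _ + X]big_ord_recr /= (@dyck_even_gt j N.+1) // mulr0 mul0r addr0.
  rewrite big_ord_recl [X in _ = X + _]big_ord_recl dyck_evenS0 -addrA; congr (_ + _).
  rewrite -big_split; apply: eq_bigr => h _ /=.
  by rewrite /bump /= add1n dyck_evenSS; ring.
rewrite -big_split; apply: eq_bigr => h _ /=.
by rewrite /v /w big_ord_recr /= [V j h]/V; ring.
Qed.

Lemma sum_dyck_even_widen N M i j : (j < N)%N -> (N <= M)%N ->
  \sum_(h < M) U i h * U j h * w h = \sum_(h < N) U i h * U j h * w h.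
Proof.
move=> lt_jN le_NM; rewrite [RHS](big_ord_widen M (fun h => U i h * U j h * w h)) //.
rewrite [RHS]big_mkcond /=; apply: eq_bigr => h _; case: ltnP => // le_Nh.
by rewrite (@dyck_even_gt j) ?mulr0 ?mul0r //; apply: leq_trans le_Nh.
Qed.

(** A closed path of length 2(i+j) is cut after 2i steps and its second half reversed. Each use of
    [dyck_even_shift] moves one step across the cut. *)
Lemma dyck_even_gram N i j : (j < N)%N ->
  \sum_(h < N) U i h * U j h * w h = U (i + j) 0.
Proof.
move=> lt_jN; rewrite -(@sum_dyck_even_widen N (N + i) i j) ?leq_addr //.
(* The induction on [j] lengthens the other prefix, so the range must exceed [i + j]; widening it
   only adds zero terms. *)
have {lt_jN} : (i + j < N + i)%N by rewrite addnC ltn_add2r.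
move: (N + i)%N => {}N; elim: j i => [|j IHj] i.
  rewrite addn0 => lt_iN; case: N lt_iN => // N _.
  rewrite big_ord_recl big1 => [|h _]; last by rewrite mulr0 mul0r.
  by rewrite /w big_ord0 /= !mulr1 addr0.
move=> lt_ijN; have lt_iN : (i < N)%N by lia.
rewrite addnS -addSn -IHj; last by rewrite addSn -addnS.
under eq_bigr do rewrite (mulrC (U i _)).
rewrite !dyck_even_shift //; last by lia.
by apply: eq_bigr => h _; rewrite (mulrC (V j _)).
Qed.

Lemma dyck_odd_gram N i j : (j < N)%N ->
  \sum_(h < N) V i h * V j h * v h = U (i + j).+1 0.
Proof. by move=> lt_jN; rewrite -dyck_even_shift // dyck_even_gram. Qed.

(* The value at 0 of the orthogonal polynomial of degree h. *)
Definition dyck_dual (h : nat) : R := \prod_(i < h) - a i.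

(** This is the expansion of x^m in the monic orthogonal polynomials, with coefficients [U m h],
    taken at x = 0. The terms cancel in pairs since [dyck_dual a h.+1 = - a h * dyck_dual a h]. *)
Lemma sum_dyck_even_dual N m : (m < N)%N ->
  \sum_(h < N) U m h * dyck_dual h = (m == 0)%:R.
Proof.
case: N => // N; rewrite ltnS.
case: m => [_|m lt_mN].
  rewrite big_ord_recl big1 => [|h _]; last by rewrite /= mul0r.
  by rewrite /dyck_dual big_ord0 mulr1 addr0.
transitivity (\sum_(h < N.+1) a h * V m h * dyck_dual h +
   \sum_(h < N.+1) V m h * dyck_dual h.+1).
  rewrite [X in _ + X]big_ord_recr /= dyck_odd_gt // mul0r addr0.
  rewrite big_ord_recl [X in _ = X + _]big_ord_recl dyck_evenS0 -addrA; congr (_ + _).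
  rewrite -big_split; apply: eq_bigr => h _ /=.
  by rewrite /bump /= add1n dyck_evenSS; ring.
rewrite -big_split big1 //= => h _.
by rewrite /dyck_dual big_ord_recr /=; ring.
Qed.

End DyckPaths.

Arguments dyck_even {R} a b m h : simpl never.
Arguments dyck_odd {R} a b m h.
Arguments even_weight {R} a b h.
Arguments odd_weight {R} a b h.
Arguments dyck_dual {R} a h.

(** * The functional equation and its Stieltjes continued fraction *)

Section SchroderSeries.

Variables (K : fieldType) (p : K).
Hypothesis p_neq_root : forall n, p ^+ n.+1 != 1.

Local Notation Q := (p ^+ 2).

Definition schroder_odd_coef (k : nat) : K := Q ^+ k * (1 + p * Q ^+ k).
Definition schroder_even_coef (k : nat) : K := p * Q ^+ (2 * k).+1.

Local Notation a := schroder_odd_coef.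
Local Notation b := schroder_even_coef.
Local Notation U := (dyck_even a b).
Local Notation V := (dyck_odd a b).

(* [airy 0] gives the coefficients of F; [airy k] those of its k-th contiguous
   series. *)
Definition airy (k n : nat) : K := \prod_(i < n) (a (k + i) / (Q ^+ i.+1 - 1)).

Lemma subQ1_neq0 i : Q ^+ i.+1 - 1 != 0.
Proof. by rewrite subr_eq0 -exprM mul2n doubleS p_neq_root. Qed.

Lemma airy0 k : airy k 0 = 1.
Proof. by rewrite /airy big_ord0. Qed.

Lemma airyS k n : airy k n.+1 = airy k n * (a (k + n) / (Q ^+ n.+1 - 1)).
Proof. by rewrite /airy big_ord_recr. Qed.

Lemma airyS_shift k n :
  airy k n.+1 = a k * airy k.+1 n / (Q ^+ n.+1 - 1).
Proof.
rewrite /airy !prodf_div big_ord_recl [in X in _ / X]big_ord_recr /= addn0.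
under eq_bigr do rewrite /bump /= add1n addnS -addSn.
by rewrite invfM !mulrA.
Qed.

(** With F_k(x) the generating series of [airy k], this reads F_k(Qx) = F_k(x) + a_k x
    F_{k+1}(x). *)
Lemma airy_odd_step k n :
  Q ^+ n.+1 * airy k n.+1 = airy k n.+1 + a k * airy k.+1 n.
Proof. by rewrite airyS_shift; field; exact: subQ1_neq0. Qed.

(** In the same notation: F_{k+1}(x) = F_k(Qx) + b_k x F_{k+1}(Qx). *)
Lemma airy_even_step k n :
  airy k.+1 n.+1 = Q ^+ n.+1 * airy k n.+1 + b k * (Q ^+ n * airy k.+1 n).
Proof.
have ne0 := subQ1_neq0 n.
apply: (mulIf ne0); rewrite (airyS_shift k) (airyS k.+1) mulrA mulfVK // mulrDl.
rewrite -!mulrA mulVf // mulr1 /a /b addSn mul2n -addnn !(exprSr Q) !exprD.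
by move: (Q ^+ k) (Q ^+ n) => x y; ring.
Qed.

(* The coefficients of the products of F with the columns of the path tables. *)
Definition conv_even h m : K := \sum_(j < m.+1) airy 0 (m - j) * U (h + j) h.
Definition conv_odd h m : K := \sum_(j < m.+1) airy 0 (m - j) * V (h + j) h.

Lemma conv_even0S m :
  conv_even 0 m.+1 = airy 0 m.+1 + a 0 * conv_odd 0 m.
Proof.
rewrite /conv_even big_ord_recl /= subn0 mulr1; congr (_ + _).
rewrite /conv_odd mulr_sumr; apply: eq_bigr => j _.
by rewrite /bump /= add1n subSS dyck_evenS0 mulrCA.
Qed.

Lemma conv_evenSS h m :
  conv_even h.+1 m.+1 = conv_odd h m.+1 + a h.+1 * conv_odd h.+1 m.
Proof.
rewrite /conv_even; under eq_bigr do rewrite addSn dyck_evenSS mulrDr.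
rewrite big_split /=; congr (_ + _).
rewrite big_ord_recl /= addn0 dyck_odd_gt // !mulr0 add0r.
rewrite /conv_odd mulr_sumr; apply: eq_bigr => j _.
by rewrite /bump /= add1n subSS addnS addSn mulrCA.
Qed.

Lemma conv_oddS h m :
  conv_odd h m.+1 = conv_even h m.+1 + b h * conv_even h.+1 m.
Proof.
rewrite /conv_odd /V; under eq_bigr do rewrite mulrDr.
rewrite big_split /=; congr (_ + _).
rewrite big_ord_recl /= addn0 dyck_even_gt // !mulr0 add0r.
rewrite /conv_even mulr_sumr; apply: eq_bigr => j _.
by rewrite /bump /= add1n subSS addnS addSn mulrCA.
Qed.

(** The path recursions for the columns, multiplied by F, are the two contiguous relations, so both
    sides agree by induction on [m] and then on [h]. *)
Lemma conv_airy m h :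
  conv_even h m = Q ^+ m * airy h m /\ conv_odd h m = airy h.+1 m.
Proof.
elim: m h => [|m IHm] h.
  rewrite /conv_even /conv_odd !big_ord1 !addn0 subn0 !airy0 dyck_odd_diag.
  by rewrite dyck_even_diag !mulr1.
elim: h => [|h [_ IHh]].
  have even : conv_even 0 m.+1 = Q ^+ m.+1 * airy 0 m.+1.
    by rewrite conv_even0S airy_odd_step (IHm 0%N).2.
  by split=> //; rewrite conv_oddS even (IHm 1%N).1 (airy_even_step 0).
have even : conv_even h.+1 m.+1 = Q ^+ m.+1 * airy h.+1 m.+1.
  by rewrite conv_evenSS airy_odd_step IHh (IHm h.+1).2.
by split=> //; rewrite conv_oddS even (IHm h.+2).1 (airy_even_step h.+1).
Qed.

Variable s : nat -> K.
Hypothesis s0 : s 0 = 1.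
Hypothesis s_rec : forall m,
  s m.+1 = s m + p * \sum_(k < m.+1) Q ^+ k * s k * s (m - k).

(** This is F(x) f(x) = F(Qx). Multiplying the equation of f by F reduces it to F(Qx) = F(x) + x
    F(Qx) + p x F(Q^2 x), which is the term ratio of [airy 0]. *)
Lemma schroder_conv_airy m :
  \sum_(j < m.+1) airy 0 (m - j) * s j = Q ^+ m * airy 0 m.
Proof.
elim/ltn_ind: m => -[_|m IHm]; first by rewrite big_ord1 s0 airy0 mul1r.
rewrite big_ord_recl s0 subn0 mulr1.
under eq_bigr do rewrite lift0 subSS s_rec mulrDr.
rewrite big_split /= IHm //.
(* The coefficient of f(Qx) f(x) F(x): the induction hypothesis turns f(x) F(x) into F(Qx), and
   then, with x replaced by Qx, f(Qx) F(Qx) into F(Q^2 x). *)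
suff -> : \sum_(j < m.+1) airy 0 (m - j) *
    (p * \sum_(k < j.+1) Q ^+ k * s k * s (j - k))
  = p * (Q ^+ m * (Q ^+ m * airy 0 m)).
  rewrite airyS add0n /a; field; exact: subQ1_neq0.
under eq_bigr do rewrite mulrCA.
rewrite -mulr_sumr; congr (p * _).
pose F := \poly_(i < m.+1) airy 0 i; pose S := \poly_(i < m.+1) s i.
pose T := \poly_(i < m.+1) (Q ^+ i * s i).
have FS i : (i <= m)%N -> (S * F)`_i = Q ^+ i * airy 0 i.
  move=> le_im; rewrite -IHm // coefM; apply: eq_bigr => j _.
  by rewrite !coef_poly !ifT 1?mulrC //; have := ltn_ord j; lia.
(* The double sum is reassociated as a product of truncated polynomials. *)
transitivity ((T * S * F)`_m).
  rewrite mulrC coefMr; apply: eq_bigr => -[j lt_jm] _ /=.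
  rewrite coef_poly ifT; last by lia.
  congr (_ * _); rewrite coefM; apply: eq_bigr => -[k lt_kj] _ /=.
  by rewrite !coef_poly !ifT //; lia.
rewrite -mulrA coefM -(IHm m) // !mulr_sumr; apply: eq_bigr => -[j lt_jm] _ /=.
rewrite FS ?leq_subr // coef_poly ifT //.
have -> : Q ^+ m = Q ^+ j * Q ^+ (m - j) by rewrite -exprD subnKC.
by ring.
Qed.

(** Both sequences convolve with [airy 0] to the same result, and [airy 0] starts with 1, so it can
    be cancelled. *)
Lemma schroder_dyck m : s m = U m 0.
Proof.
elim/ltn_ind: m => m IHm.
have := (conv_airy m 0).1; rewrite -schroder_conv_airy /conv_even.
rewrite !big_ord_recr /= !subnn airy0 !mul1r add0n => /esym.
rewrite (eq_bigr (fun j : 'I_m => airy 0 (m - j) * U (0 + j) 0)).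
  by move/addrI.
by move=> j _; rewrite IHm.
Qed.

End SchroderSeries.

(** * Determinants and minors of triangular factorizations *)

Section TriangularMatrices.

Lemma det_unitriangular_gram (R : comNzRingType) (n : nat)
    (T : nat -> nat -> R) (l r w : nat -> R) :
    (forall i h, (i < h)%N -> T i h = 0) -> (forall i, T i i = 1) ->
  \det (\matrix_(i < n, h < n) (l i * T i h) *m
        \matrix_(h < n, j < n) (w h * r j * T j h))
  = \prod_(i < n) (l i * r i * w i).
Proof.
move=> T_gt T_diag; rewrite det_mulmx -[X in _ * X]det_tr.
rewrite !det_trig.
- rewrite -big_split; apply: eq_bigr => i _ /=.
  by rewrite !mxE T_diag; ring.
- by apply/is_trig_mxP => i j lt_ij; rewrite !mxE T_gt ?mulr0.
- by apply/is_trig_mxP => i j lt_ij; rewrite !mxE T_gt ?mulr0.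
Qed.

(** Here [x] is the first row of the inverse of [R] and [y] solves [L *m y = delta_mx 0 0], so
    [x *m y] plays the part of entry (0,0) of the inverse of [L *m R]; Cramer's rule gives the
    minor. *)
Lemma det_minor_mulmx (K : fieldType) (n : nat) (L R : 'M[K]_n.+1)
    (x : 'rV_n.+1) (y : 'cV_n.+1) :
    R \in unitmx -> L *m y = delta_mx 0 0 -> x *m R = delta_mx 0 0 ->
  \det (row' 0 (col' 0 (L *m R))) = \det (L *m R) * (x *m y) 0 0.
Proof.
move=> uR Ly xR; pose z := invmx R *m y.
have Rz : R *m z = y by rewrite mulKVmx.
have -> : x *m y = delta_mx 0 0 *m z by rewrite -xR -mulmxA Rz.
have /(congr1 (fun A : 'M_(n.+1, 1) => A 0 0)) :
    \adj (L *m R) *m delta_mx 0 0 = \det (L *m R) *: z.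
  by rewrite -Ly -Rz (mulmxA L) mulmxA mul_adj_mx mul_scalar_mx.
rewrite -colE -rowE !mxE /cofactor => <-.
by rewrite expr0 mul1r.
Qed.

End TriangularMatrices.

(** The factor [f k] occurs in the prefix products for [i] from [k] to [n - 1]. *)
Lemma prod_prefix_prod (R : comNzRingType) (f : nat -> R) n :
  \prod_(i < n) \prod_(1 <= k < i.+1) f k = \prod_(1 <= k < n) f k ^+ (n - k).
Proof.
elim: n => [|n IHn]; first by rewrite big_ord0 big_geq.
rewrite big_ord_recr /= IHn; case: n {IHn} => [|n].
  by rewrite !big_geq // mulr1.
rewrite [RHS]big_nat_recr // [X in _ * X = _]big_nat_recr //= subSnn mulrA; congr (_ * _).
rewrite -big_split /= !big_nat; apply: eq_bigr => k /andP[_ lt_kn].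
by rewrite -exprSr -subSn 1?ltnW.
Qed.

(** * Evaluation of the three determinants over a field *)

Section QHankel.

Variables (K : fieldType) (q : K) (S : nat -> K).
Hypothesis q_neq0 : q != 0.
Hypothesis q_neq_root : forall n, q ^+ n.+1 != 1.
Hypothesis S0 : S 0%N = 1.
Hypothesis S_rec : forall m, S m.+1 = q ^+ (2 * m).+1 * S m
  + \sum_(k < m.+1) q ^+ (2 * k.+1 * (m - k)) * S (m - k) * S k.

Local Notation p := (q^-1).
Local Notation a := (schroder_odd_coef K p).
Local Notation b := (schroder_even_coef K p).
Local Notation U := (dyck_even a b).
Local Notation V := (dyck_odd a b).
Local Notation w := (even_weight a b).
Local Notation v := (odd_weight a b).

Lemma pX_neq1 n : p ^+ n.+1 != 1.
Proof. by rewrite exprVn invr_eq1. Qed.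

Lemma mulqp i j : q ^+ i * p ^+ (i + j) = p ^+ j.
Proof. by rewrite exprD mulrA -exprMn divff // expr1n mul1r. Qed.

Lemma S_dyck m : S m = q ^+ (m ^ 2) * U m 0.
Proof.
rewrite -(@schroder_dyck K p pX_neq1 (fun m => p ^+ (m ^ 2) * S m)).
- by rewrite mulrA -exprMn divff // expr1n mul1r.
- by rewrite S0 mulr1.
move=> {}m; rewrite S_rec mulrDr; congr (_ + _).
  rewrite mulrA (mulrC (p ^+ _)).
  have -> : (m.+1 ^ 2 = (2 * m).+1 + m ^ 2)%N by lia.
  by rewrite mulqp.
rewrite !mulr_sumr; apply: eq_bigr => -[k /= lt_km] _.
have [d ->] : exists d, m = (d + k)%N by exists (m - k)%N; lia.
rewrite addnK.
(* After cancelling the power of [q] in the recursion, the remaining exponent of [p] splits as p *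
   Q^k * p^(d^2) * p^(k^2). *)
have -> : ((d + k).+1 ^ 2 = 2 * k.+1 * d + (1 + 2 * k + d ^ 2 + k ^ 2))%N by lia.
rewrite !mulrA (mulrC (p ^+ _)) mulqp mul2n -addnn !exprD expr1 [p ^+ 2]expr2 exprMn; ring.
Qed.

Lemma mulqpK i j : q ^+ (i + j) * p ^+ j = q ^+ i.
Proof. by rewrite exprD -mulrA -exprMn divff // expr1n mulr1. Qed.

(** The term [i] stays on the left to avoid subtraction in [nat]; it reappears as the row factor
    [p ^+ i]. *)
Lemma Sexp_square i j : (Sexp i j + (i + j) ^ 2 + i = 2 * i ^ 2 + 2 * j ^ 2 + j)%N.
Proof. by have := SexpE i j; lia. Qed.

Lemma q_entry0 i j : q ^+ Sexp i j * S (i + j) =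
  (q ^+ (2 * i ^ 2) * p ^+ i) * q ^+ (2 * j ^ 2 + j) * U (i + j) 0.
Proof.
rewrite S_dyck mulrA -exprD -(mulqpK _ i) Sexp_square.
by rewrite -addnA exprD; congr (_ * _); rewrite mulrAC.
Qed.

Lemma q_entry1 i j : q ^+ Sexp i j * S (i + j).+1 =
  q ^+ (2 * i ^ 2 + i) * q ^+ (2 * j ^ 2 + 3 * j + 1) * U (i + j).+1 0.
Proof.
rewrite S_dyck mulrA -!exprD; congr (q ^+ _ * _).
by have := Sexp_square i j; lia.
Qed.

Definition qprod h := \prod_(1 <= k < h.+1) (q ^+ (2 * k - 1) + 1).

Lemma qprodS h : qprod h.+1 = qprod h * (q ^+ (2 * h).+1 + 1).
Proof.
rewrite /qprod big_nat_recr //=; congr (_ * (q ^+ _ + 1)); lia.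
Qed.

Lemma q_odd_coef h : q ^+ (4 * h).+1 * a h = q ^+ (2 * h).+1 + 1.
Proof.
rewrite /schroder_odd_coef -exprM mulrA.
have -> : ((4 * h).+1 = (2 * h).+1 + 2 * h)%N by lia.
rewrite exprD -[_ * p ^+ _]mulrA -exprMn divff // expr1n mulr1 mulrDr mulr1.
by congr (_ + _); rewrite -exprS -exprMn divff // expr1n.
Qed.

Lemma q_even_coef h : q ^+ (4 * h + 3) * b h = 1.
Proof.
rewrite /schroder_even_coef -exprM -exprS.
have -> : ((2 * (2 * h).+1).+1 = 4 * h + 3)%N by lia.
by rewrite -exprMn divff // expr1n.
Qed.

(** The exponent 4h^2 = (2h^2 - h) + (2h^2 + h) is the combined row and column scaling at diagonal
    position [h], so this is the pivot of the factorization. *)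
Lemma q_even_weight h : q ^+ (4 * h ^ 2) * w h = qprod h.
Proof.
elim: h => [|h IHh]; first by rewrite /even_weight big_ord0 /qprod big_geq // mulr1.
rewrite qprodS -IHh -q_odd_coef /even_weight big_ord_recr /=.
have -> : (4 * h.+1 ^ 2 = 4 * h ^ 2 + (4 * h).+1 + (4 * h + 3))%N by lia.
rewrite (exprD q (_ + _)) (exprD q (4 * h ^ 2)) -[RHS]mulr1 -(q_even_coef h).
by move: (q ^+ _) (q ^+ (4 * h ^ 2)) (q ^+ (4 * h + 3)) => x y z; ring.
Qed.

Lemma q_odd_weight h : q ^+ (4 * h ^ 2 + 4 * h + 1) * v h = qprod h.+1.
Proof.
rewrite qprodS -q_even_weight -q_odd_coef /odd_weight -addnA addn1 exprD.
by rewrite mulrACA.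
Qed.

Definition qschroder_mx (t n : nat) : 'M[K]_n :=
  \matrix_(i < n, j < n) (q ^+ Sexp i j * S (i + j + t)).

Definition q_lower n : 'M[K]_n :=
  \matrix_(i < n, h < n) (q ^+ (2 * i ^ 2) * p ^+ i * U i h).

Definition q_upper n : 'M[K]_n :=
  \matrix_(h < n, j < n) (w h * q ^+ (2 * j ^ 2 + j) * U j h).

Lemma qschroder_mx0_lu n : qschroder_mx 0 n = q_lower n *m q_upper n.
Proof.
apply/matrixP => i j; rewrite !mxE addn0 q_entry0.
rewrite -(dyck_even_gram _ a b n i j) // mulr_sumr.
by apply: eq_bigr => h _; rewrite !mxE; ring.
Qed.

Lemma det_qschroder_mx0 n : \det (qschroder_mx 0 n) = \prod_(i < n) qprod i.
Proof.
rewrite qschroder_mx0_lu /q_lower /q_upper.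
rewrite (det_unitriangular_gram _ n U (fun i => q ^+ (2 * i ^ 2) * p ^+ i)
  (fun j => q ^+ (2 * j ^ 2 + j)) w).
- apply: eq_bigr => i _; rewrite -q_even_weight; congr (_ * _).
  rewrite mulrAC -exprD addnA mulqpK; congr (q ^+ _); lia.
- exact: dyck_even_gt.
- exact: dyck_even_diag.
Qed.

Lemma det_qschroder_mx1 n : \det (qschroder_mx 1 n) = \prod_(i < n) qprod i.+1.
Proof.
pose l i := q ^+ (2 * i ^ 2 + i).
pose r j := q ^+ (2 * j ^ 2 + 3 * j + 1).
have -> : qschroder_mx 1 n = \matrix_(i < n, h < n) (l i * V i h) *m
    \matrix_(h < n, j < n) (v h * r j * V j h).
  apply/matrixP => i j; rewrite !mxE addn1 q_entry1.
  rewrite -(dyck_odd_gram _ a b n i j) // mulr_sumr.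
  by apply: eq_bigr => h _; rewrite !mxE /l /r; ring.
rewrite det_unitriangular_gram.
- apply: eq_bigr => i _; rewrite -q_odd_weight /l /r -exprD; congr (q ^+ _ * _).
  by lia.
- exact: dyck_odd_gt.
- by move=> i; rewrite dyck_odd_diag dyck_even_diag.
Qed.

Lemma qX_neqN1 n : q ^+ n.+1 + 1 != 0.
Proof.
(* If q^(n+1) were -1, its square q^(2n+2) would be 1. *)
apply: contra_neq (q_neq_root (n.+1 + n)) => /eqP.
by rewrite addr_eq0 -addnS exprD => /eqP ->; rewrite mulrNN mulr1.
Qed.

Lemma qprod_neq0 h : qprod h != 0.
Proof.
elim: h => [|h IHh]; first by rewrite /qprod big_geq // oner_neq0.
by rewrite qprodS mulf_neq0 ?qX_neqN1.
Qed.

Lemma even_weight_neq0 h : w h != 0.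
Proof.
by have := qprod_neq0 h; rewrite -q_even_weight mulf_eq0 negb_or => /andP[].
Qed.

(** The left side is the product of the ratios a_i / b_i = q^2 (q^(2i+1) + 1). *)
Lemma q_dual_sqr h : dyck_dual a h ^+ 2 / w h = q ^+ (2 * h) * qprod h.
Proof.
elim: h => [|h IHh].
  by rewrite /dyck_dual /even_weight !big_ord0 /qprod big_geq // divr1 expr1n mulr1.
have b_inv : (b h)^-1 = q ^+ (4 * h + 3).
  by apply: mulr1_eq; rewrite mulrC q_even_coef.
have a_neq0 : a h != 0.
  have := qX_neqN1 (2 * h); rewrite -q_odd_coef mulf_eq0 negb_or.
  by case/andP.
have b_neq0 : b h != 0 by rewrite -invr_eq0 b_inv expf_neq0.
rewrite /dyck_dual /even_weight !big_ord_recr /= -/(dyck_dual a h) -/(w h).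
transitivity (dyck_dual a h ^+ 2 / w h * (a h / b h)).
  by field; rewrite b_neq0 a_neq0 even_weight_neq0.
rewrite IHh b_inv qprodS -q_odd_coef.
have -> : (4 * h + 3 = 2 + (4 * h).+1)%N by lia.
have -> : (2 * h.+1 = 2 * h + 2)%N by lia.
rewrite !exprD; move: (a h) (q ^+ (2 * h)) (q ^+ (4 * h).+1) => x y z; ring.
Qed.

(** The sum telescopes: q^(2h+1) [qprod h] = [qprod h.+1 - qprod h]. *)
Lemma sum_q_dual_sqr n :
  q * \sum_(h < n) (dyck_dual a h ^+ 2 / w h) = qprod n - 1.
Proof.
elim: n => [|n IHn]; first by rewrite big_ord0 mulr0 /qprod big_geq // subrr.
rewrite big_ord_recr mulrDr IHn /= q_dual_sqr qprodS mulrA -exprS.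
by ring.
Qed.

Lemma qschroder_mx2_minor n :
  qschroder_mx 2 n = row' 0 (col' 0 (qschroder_mx 0 n.+1)).
Proof.
apply/matrixP => i j; rewrite !mxE !lift0 addn0; congr (q ^+ _ * S _); last by lia.
by rewrite /Sexp; congr absz; lia.
Qed.

Lemma det_qschroder_mx2 n : q * \det (qschroder_mx 2 n) =
  \prod_(i < n.+1) qprod i * (qprod n.+1 - 1).
Proof.
(* By [sum_dyck_even_dual], [y] is sent to the first basis vector by [q_lower]. Up to column
   scaling, [q_upper] is the transposed path table with rows weighted by [w], hence the division in
   [x]. *)
pose y : 'cV_n.+1 := \col_h dyck_dual a h.
pose x : 'rV_n.+1 := \row_h (dyck_dual a h / w h).
rewrite qschroder_mx2_minor -det_qschroder_mx0 qschroder_mx0_lu.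
rewrite (det_minor_mulmx _ _ (q_lower n.+1) (q_upper n.+1) x y).
- rewrite mulrCA -sum_q_dual_sqr; congr (_ * (_ * _)).
  by rewrite mxE; apply: eq_bigr => h _; rewrite !mxE mulrAC.
- have : \det (qschroder_mx 0 n.+1) != 0.
    by rewrite det_qschroder_mx0; apply/prodf_neq0 => i _; exact: qprod_neq0.
  rewrite qschroder_mx0_lu det_mulmx mulf_eq0 negb_or => /andP[_].
  by rewrite unitmxE unitfE.
- apply/colP => i; rewrite !mxE.
  under eq_bigr do rewrite !mxE -mulrA.
  rewrite -mulr_sumr sum_dyck_even_dual // andbT.
  rewrite -[i == 0]val_eqE /=.
  have [->|_] := eqVneq (i : nat) 0%N; last by rewrite mulr0.
  by rewrite !expr0 !mulr1.
- apply/rowP => j; rewrite !mxE.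
  transitivity (q ^+ (2 * j ^ 2 + j) * \sum_(h < n.+1) U j h * dyck_dual a h).
    rewrite mulr_sumr; apply: eq_bigr => h _; rewrite !mxE.
    by rewrite -!mulrA mulKf ?even_weight_neq0 // mulrCA [dyck_dual _ _ * _]mulrC.
  rewrite sum_dyck_even_dual // eqxx /=.
  rewrite -[j == 0]val_eqE /=.
  have [->|_] := eqVneq (j : nat) 0%N; last by rewrite mulr0.
  by rewrite !expr0 !mulr1.
Qed.

End QHankel.

(** * Transfer between integer polynomials and their fraction field *)

Lemma tofracX_neq0 : tofrac 'X != 0 :> {fraction {poly int}}.
Proof. by rewrite tofrac_eq0 polyX_eq0. Qed.

Lemma tofracX_neq_root n : (tofrac 'X : {fraction {poly int}}) ^+ n.+1 != 1.
Proof.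
rewrite -tofracXn -tofrac1 tofrac_eq; apply/eqP => /(congr1 (size \o val)).
by rewrite /= size_polyXn size_poly1.
Qed.

Lemma tofrac_Sq_rec m :
  tofrac (Sq m.+1) = (tofrac 'X) ^+ (2 * m).+1 * tofrac (Sq m)
    + \sum_(k < m.+1) (tofrac 'X) ^+ (2 * k.+1 * (m - k))
                      * tofrac (Sq (m - k)) * tofrac (Sq k).
Proof.
rewrite Sq_rec // (subn1 m.+1) /= rmorphD rmorphM rmorphXn rmorph_sum big_mkord.
congr (_ ^+ _ * _ + _); first by lia.
by apply: eq_bigr => k _; rewrite !rmorphM rmorphXn addn1.
Qed.

Local Notation qmx :=
  (qschroder_mx {fraction {poly int}} (tofrac 'X) (fun m => tofrac (Sq m))).

Lemma tofrac_det_Smx t n : tofrac (\det (Smx t n)) = \det (qmx t n).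
Proof.
rewrite -det_map_mx; congr (\det _); apply/matrixP => i j.
by rewrite !mxE rmorphM rmorphXn.
Qed.

Lemma tofrac_qprod h :
  tofrac (\prod_(1 <= k < h.+1) ('X ^+ (2 * k - 1) + 1)) =
  qprod {fraction {poly int}} (tofrac 'X) h.
Proof.
by rewrite /qprod rmorph_prod; apply: eq_bigr => k _; rewrite rmorphD rmorphXn rmorph1.
Qed.

Lemma tofrac_prod_qprod n :
  \prod_(i < n) qprod {fraction {poly int}} (tofrac 'X) i =
  tofrac (\prod_(1 <= k < n) ('X ^+ (2 * k - 1) + 1) ^+ (n - k)).
Proof.
rewrite -prod_prefix_prod rmorph_prod.
by apply: eq_bigr => i _; exact: (esym (tofrac_qprod i)).
Qed.

Theorem theorem5p3 (n : nat) (n_gt0 : (0 < n)%N) :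
  (\det (Smx 1 (n - 1)) = \det (Smx 0 n)
   /\ \det (Smx 0 n) = \prod_(1 <= k < n) ('X ^+ (2 * k - 1) + 1) ^+ (n - k))
  /\ (* q^{-1} is taken in the fraction field of {poly int} *)
  tofrac (\det (Smx 2 n)) =
    (tofrac 'X)^-1
    * tofrac (\prod_(1 <= k < n.+1) ('X ^+ (2 * k - 1) + 1) ^+ (n + 1 - k))
    * tofrac (\prod_(1 <= k < n.+2) ('X ^+ (2 * k - 1) + 1) - 1).
Proof.
have q0 := tofracX_neq0; have q_root := tofracX_neq_root.
have S0 : tofrac (Sq 0) = 1 :> {fraction {poly int}} by rewrite Sq_0 tofrac1.
have det0 m := det_qschroder_mx0 _ _ _ q0 q_root S0 tofrac_Sq_rec m.
split; first split.
- apply/eqP; rewrite -tofrac_eq !tofrac_det_Smx det0.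
  rewrite (det_qschroder_mx1 _ _ _ q0 q_root S0 tofrac_Sq_rec).
  (* The two products differ only by the factor [qprod 0], an empty product. *)
  case: n n_gt0 => // n _; rewrite subn1 big_ord_recl.
  by rewrite [X in _ == X * _]big_geq // mul1r.
- by apply/eqP; rewrite -tofrac_eq tofrac_det_Smx det0 tofrac_prod_qprod.
rewrite tofrac_det_Smx -mulrA; apply: (mulfI q0); rewrite mulVKf //.
rewrite (det_qschroder_mx2 _ _ _ q0 q_root S0 tofrac_Sq_rec).
by rewrite tofrac_prod_qprod addn1 tofracB tofrac1 tofrac_qprod.
Qed.
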